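(* Let $d\ge 1$ and let $P$ be a polytopal subset of $\mathbb{R}^d$. For $q\in\mathbb{R}^d$ let $C_q$ be the local cone of $P$ at $q$, and put $R := \{p \in C_q : -p \notin C_q\}$ and $G := \{p \in \partial C_q : -p \in \partial C_q\}$. If there is a point $q \in \mathbb{R}^d$ such that $\langle G \rangle \cap \operatorname{Conv}(R) \neq \emptyset$, where $\langle G\rangle$ is the linear span of $G$ and $\operatorname{Conv}(R)$ is the convex hull of $R$, then $P$ is not the positivity set of any hinge function $h:\mathbb{R}^d\to\mathbb{R}$.
   Context: A hinge function on $\mathbb{R}^d$ is a function $h:\mathbb{R}^d\to\mathbb{R}$ of the form $h(\boldsymbol{x}) = L_0(\boldsymbol{x}) + \sum_{i=1}^s |L_i(\boldsymbol{x})| - \sum_{j=s+1}^t |L_j(\boldsymbol{x})|$ for some integers $0\le s\le t$, where $L_0,L_1,\dots,L_t:\mathbb{R}^d\to\mathbb{R}$ are affine linear functions (possibly constant). The positivity set of $h$ is $\{\boldsymbol{x}\in\mathbb{R}^d : h(\boldsymbol{x})>0\}$. A polytopal set in $\mathbb{R}^d$ is a finite union of open, possibly unbounded, polytopes (an open polytope being an intersection of finitely many open half-spaces; the whole space, as the empty intersection, and the empty set are allowed). A polytopal cone is a polytopal set $C$ such that $p\in C$ implies $\lambda p\in C$ for every real $\lambda>0$. Local cone: let $P\subseteq\mathbb{R}^d$ be polytopal and $q\in\mathbb{R}^d$. Take $\epsilon>0$ small enough that $P\cap B_\epsilon(q)$ looks like a cone with apex $q$, i.e. whenever $p\in P\cap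 B_\epsilon(q)$ with $p\neq q$, all points $q+\lambda(p-q)$ with $\lambda>0$ lying in the open ball $B_\epsilon(q)$ belong to $P$. The local cone of $P$ at $q$ is $C_q := \{\lambda (p-q) : p\in P\cap B_\epsilon(q),\ \lambda>0\}$; it is a polytopal cone and does not depend on the choice of such $\epsilon$. $\partial C_q$ denotes the topological boundary of $C_q$. The linear span of the empty set is $\{\boldsymbol{0}\}$, and the convex hull of the empty set is empty. *)

(* Defs.v *)
(* Points of R^d are row vectors 'rV[R]_d. *)
From mathcomp Require Import all_boot all_order all_algebra.
From mathcomp Require Import boolp classical_sets reals topology normedtype.

Set Implicit Arguments.
Unset Strict Implicit.
Unset Printing Implicit Defensive.

Import Order.TTheory GRing.Theory Num.Theory.
Import numFieldNormedType.Exports.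

Local Open Scope classical_set_scope.
Local Open Scope ring_scope.

Definition dotp (R : realType) (d : nat) (u v : 'rV[R]_d) : R :=
  \sum_(i < d) u 0 i * v 0 i.

(* The library norm on matrices is the sup norm, hence this explicit Euclidean
   ball. *)
Definition eball (R : realType) (d : nat) (q : 'rV[R]_d) (e : R) :
    set 'rV[R]_d :=
  [set x | Num.sqrt (dotp (x - q) (x - q)) < e].

Definition affine_function (R : realType) (d : nat) (L : 'rV[R]_d -> R) : Prop :=
  exists (a : 'rV[R]_d) (b : R), forall x, L x = dotp a x + b.

Definition hinge_function (R : realType) (d : nat) (h : 'rV[R]_d -> R) : Prop :=
  exists (s t : nat) (L : nat -> 'rV[R]_d -> R),
    [/\ (s <= t)%N,
        forall i, (i <= t)%N -> affine_function (L i) &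
        forall x, h x = L 0%N x + \sum_(1 <= i < s.+1) `|L i x|
                                - \sum_(s.+1 <= j < t.+1) `|L j x|].

Definition positivity_set (R : realType) (d : nat) (h : 'rV[R]_d -> R) :
    set 'rV[R]_d :=
  [set x | 0 < h x].

Definition open_half_space (R : realType) (d : nat) (H : set 'rV[R]_d) : Prop :=
  exists (a : 'rV[R]_d) (b : R), a != 0 /\ H = [set x | dotp a x < b].

(* Possibly unbounded; for n = 0 the intersection is the whole space. *)
Definition open_polytope (R : realType) (d : nat) (Q : set 'rV[R]_d) : Prop :=
  exists (n : nat) (H : 'I_n -> set 'rV[R]_d),
    (forall i, open_half_space (H i)) /\ Q = \bigcap_i H i.

Definition polytopal (R : realType) (d : nat) (P : set 'rV[R]_d) : Prop :=
  exists (n : nat) (Q : 'I_n -> set 'rV[R]_d),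
    (forall i, open_polytope (Q i)) /\ P = \bigcup_i Q i.

(* The radius e is small enough for P to look like a cone with apex q inside
   the ball of radius e around q. *)
Definition conical_radius (R : realType) (d : nat) (P : set 'rV[R]_d)
    (q : 'rV[R]_d) (e : R) : Prop :=
  0 < e /\
  forall p, P p -> eball q e p -> p != q ->
  forall l : R, 0 < l ->
    eball q e (q + l *: (p - q)) -> P (q + l *: (p - q)).

(* [is_local_cone P q C] : C is the local cone of P at q.  For polytopal P
   such a C exists and is unique, i.e., independent of the radius e. *)
Definition is_local_cone (R : realType) (d : nat) (P : set 'rV[R]_d)
    (q : 'rV[R]_d) (C : set 'rV[R]_d) : Prop :=
  exists e : R, conical_radius P q e /\
    C = [set v | exists (p : 'rV[R]_d) (l : R),
                   [/\ P p, eball q e p, 0 < l & v = l *: (p - q)]].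

Definition boundary (T : topologicalType) (A : set T) : set T :=
  closure A `\` interior A.

Definition linear_span (R : realType) (d : nat) (A : set 'rV[R]_d) :
    set 'rV[R]_d :=
  [set v | exists (n : nat) (g : 'I_n -> 'rV[R]_d) (c : 'I_n -> R),
             (forall i, A (g i)) /\ v = \sum_(i < n) c i *: g i].

Definition convex_hull (R : realType) (d : nat) (A : set 'rV[R]_d) :
    set 'rV[R]_d :=
  [set v | exists (n : nat) (g : 'I_n -> 'rV[R]_d) (c : 'I_n -> R),
             [/\ forall i, A (g i), forall i, 0 <= c i,
                 \sum_(i < n) c i = 1 & v = \sum_(i < n) c i *: g i]].

Definition unpaired_part (R : realType) (d : nat) (C : set 'rV[R]_d) :
    set 'rV[R]_d :=
  [set p | C p /\ ~ C (- p)].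

Definition paired_boundary (R : realType) (d : nat) (C : set 'rV[R]_d) :
    set 'rV[R]_d :=
  [set p | boundary C p /\ boundary C (- p)].

(* Main.v *)
Require Import Defs.
From HB Require Import structures.
From mathcomp Require Import all_boot all_order all_algebra.
From mathcomp Require Import boolp classical_sets reals topology normedtype.
From mathcomp Require Import ring lra.
Import Order.TTheory GRing.Theory Num.Theory.
Import numFieldNormedType.Exports.
Local Open Scope classical_set_scope.
Local Open Scope ring_scope.

(** Near [q] a hinge function [h] satisfies
    [h (q + v) = h q + l v + g v] with [l] linear and [g] even and positively
    homogeneous.  If [h q] is nonzero, the local cone of [{h > 0}] is empty or
    the whole space, so [R] is empty.  If [h q = 0], the local cone is
    [{l + g > 0}]; since [2 l v = (l + g) v - (l + g) (- v)], the linear form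
    [l] is positive on [R], hence on its convex hull, and vanishes on [G],
    hence on its span. *)

(** * Linear forms, and small steps along a ray *)

Section DotProduct.
Context {R : realType} {d : nat}.
Implicit Types (a b u v : 'rV[R]_d).

Fact dotp_is_linear a : linear (dotp a : 'rV[R]_d -> R^o).
Proof.
move=> c u v; rewrite /dotp scaler_sumr -big_split /=; apply: eq_bigr => i _.
by rewrite !mxE mulrDr mulrCA.
Qed.

HB.instance Definition _ a :=
  GRing.isLinear.Build R 'rV[R]_d R^o _ (dotp a) (dotp_is_linear a).

Lemma dotpC u v : dotp u v = dotp v u.
Proof. by apply: eq_bigr => i _; rewrite mulrC. Qed.

Lemma dotpDr a u v : dotp a (u + v) = dotp a u + dotp a v.
Proof. exact: linearD. Qed.

Lemma dotpNr a v : dotp a (- v) = - dotp a v.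
Proof. exact: linearN. Qed.

Lemma dotpZr a c v : dotp a (c *: v) = c * dotp a v.
Proof. exact: linearZ. Qed.

Lemma dotp_sumr a n (c : 'I_n -> R) (g : 'I_n -> 'rV[R]_d) :
  dotp a (\sum_i c i *: g i) = \sum_i c i * dotp a (g i).
Proof. by rewrite linear_sum; apply: eq_bigr => i _; exact: dotpZr. Qed.

Lemma dotpDl a b v : dotp (a + b) v = dotp a v + dotp b v.
Proof. by rewrite dotpC dotpDr !(dotpC v). Qed.

Lemma dotpNl a v : dotp (- a) v = - dotp a v.
Proof. by rewrite dotpC dotpNr dotpC. Qed.

Lemma dotp0l v : dotp 0 v = 0.
Proof. by rewrite dotpC [LHS]linear0. Qed.

Lemma dotp_continuous a : continuous (dotp a).
Proof.
rewrite /dotp; apply: continuous_big => [|i _ x].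
  exact: add_continuous.
exact: cvgMl_tmp (@coord_continuous R 1 d 0 i x).
Qed.

Lemma sqrt_dotpZ m v :
  0 <= m -> Num.sqrt (dotp (m *: v) (m *: v)) = m * Num.sqrt (dotp v v).
Proof.
move=> m0; rewrite dotpZr (dotpC (m *: v)) dotpZr mulrA -expr2 sqrtrM ?sqr_ge0//.
by rewrite sqrtr_sqr ger0_norm.
Qed.

Lemma near0_ray v (Q : set 'rV[R]_d) :
  (\forall w \near (0 : 'rV[R]_d), Q w) -> \forall m \near 0^'+, Q (m *: v).
Proof.
move=> Q0; suff : (m *: v) @[m --> 0^'+] --> (0 : 'rV[R]_d) by exact.
rewrite -[X in _ --> X](scale0r v).
by apply: cvg_at_right_filter; apply: scalel_continuous.
Qed.

Lemma near_eball_ray (q v : 'rV[R]_d) (e : R) :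
  0 < e -> \forall m \near 0^'+, eball q e (q + m *: v).
Proof.
set s := Num.sqrt (dotp v v); have s0 : 0 <= s := sqrtr_ge0 _.
have s1 : 0 < s + 1 by rewrite ltr_wpDl.
move=> e0; near=> m; have m0 : 0 < m by near: m; exact: nbhs_right_gt.
rewrite /eball /= addrAC subrr add0r sqrt_dotpZ ?ltW//.
(* Bounding by [s + 1] instead of [s] keeps the divisor in [e / (s + 1)] positive even when
   [v = 0]. *)
apply: (@le_lt_trans _ _ (m * (s + 1))); first by rewrite ler_pM2l// lerDl.
by rewrite -ltr_pdivlMr//; near: m; apply: nbhs_right_lt; apply: divr_gt0.
Unshelve. all: by end_near. Qed.

End DotProduct.

(** * Exact local expansions of hinge functions *)

Section LocalSplitting.
Context {R : realType} {d : nat}.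
Implicit Types (f h : 'rV[R]_d -> R) (q v a : 'rV[R]_d).

(** The expansion is an identity near [q], with no error term: [dotp a] is the odd part and [g] the
    even part of the one-sided directional derivative. In this form the property is stable under
    sums and negation; continuity of [g] gives persistence of sign and control of boundaries. *)
Definition splits_at q f := exists (a : 'rV[R]_d) (g : 'rV[R]_d -> R),
  [/\ forall v, g (- v) = g v,
      forall m v, 0 <= m -> g (m *: v) = m * g v,
      continuous g &
      \forall v \near (0 : 'rV[R]_d), f (q + v) = f q + (dotp a v + g v)].

Lemma splits_at_affine q f : affine_function f -> splits_at q f.
Proof.
move=> [a [b fE]]; exists a, (fun=> 0); split => [//|m v _|x|].
- by rewrite mulr0.
- exact: cst_continuous.
- by apply: filterE => v; rewrite !fE dotpDr; ring.
Qed.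

Lemma splits_atN q f : splits_at q f -> splits_at q (fun x => - f x).
Proof.
move=> [a [g [gN gZ gc fE]]]; exists (- a), (fun v => - g v).
split => [v|m v m0|x|].
- by rewrite gN.
- by rewrite gZ// mulrN.
- exact: cvgN (gc x).
- by apply: filterS fE => v ->; rewrite dotpNl; ring.
Qed.

Lemma splits_atD q f1 f2 :
  splits_at q f1 -> splits_at q f2 -> splits_at q (fun x => f1 x + f2 x).
Proof.
move=> [a1 [g1 [gN1 gZ1 gc1 fE1]]] [a2 [g2 [gN2 gZ2 gc2 fE2]]].
exists (a1 + a2), (fun v => g1 v + g2 v); split => [v|m v m0|x|].
- by rewrite gN1 gN2.
- by rewrite gZ1// gZ2// mulrDr.
- exact: cvgD (gc1 x) (gc2 x).
- by apply: filterS2 fE1 fE2 => v -> ->; rewrite dotpDl; ring.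
Qed.

Lemma splits_at_sum q (s : seq nat) (F : nat -> 'rV[R]_d -> R) :
  (forall i, i \in s -> splits_at q (F i)) ->
  splits_at q (fun x => \sum_(i <- s) F i x).
Proof.
elim: s => [|i s IHs] Fs.
  under eq_fun do rewrite big_nil.
  by apply: splits_at_affine; exists 0, 0 => x; rewrite dotp0l addr0.
under eq_fun do rewrite big_cons.
apply: splits_atD; first by apply: Fs; rewrite mem_head.
by apply: IHs => j js; apply: Fs; rewrite in_cons js orbT.
Qed.

Lemma splits_at_near q f1 f2 : f1 q = f2 q ->
  (\forall v \near (0 : 'rV[R]_d), f1 (q + v) = f2 (q + v)) ->
  splits_at q f2 -> splits_at q f1.
Proof.
move=> e0 e12 [a [g [gN gZ gc fE]]]; exists a, g; split => //.
by apply: filterS2 e12 fE => v -> ->; rewrite e0.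
Qed.

Lemma splits_at_near_gt0 q f : splits_at q f -> 0 < f q ->
  \forall v \near (0 : 'rV[R]_d), 0 < f (q + v).
Proof.
move=> [a [g [gN gZ gc fE]]] fq.
(* Homogeneity includes the factor [m = 0]. *)
have g0 : g 0 = 0 by rewrite -(scale0r 0) gZ// mul0r.
have : f q + (dotp a v + g v) @[v --> (0 : 'rV[R]_d)] --> f q + (dotp a 0 + g 0).
  exact: cvgD (cvg_cst _) (cvgD (dotp_continuous a 0) (gc 0)).
rewrite [dotp a 0]linear0 g0 !addr0 => /cvgr_gt/(_ _ fq).
by apply: filterS2 fE => v ->.
Qed.

(** If [f q] is nonzero, the absolute value agrees near [q] with [f] or [- f], which is affine. If
    [f q = 0], the increment is the absolute value of [dotp a v], which is purely even. *)
Lemma splits_at_norm_affine q f :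
  affine_function f -> splits_at q (fun x => `|f x|).
Proof.
move=> fA; have [a [b fE]] := fA.
have [fq|fq|fq] := ltrgtP 0 (f q).
- apply: (@splits_at_near _ _ f); last exact: splits_at_affine.
    by rewrite gtr0_norm.
  apply: filterS (splits_at_near_gt0 _ _ (splits_at_affine q _ fA) fq) => v.
  exact: gtr0_norm.
- have NfA : affine_function (fun x => - f x).
    by exists (- a), (- b) => x; rewrite fE dotpNl opprD.
  have Nfq : 0 < - f q by rewrite oppr_gt0.
  apply: (@splits_at_near _ _ (fun x => - f x)); last exact: splits_at_affine.
    by rewrite ltr0_norm.
  apply: filterS (splits_at_near_gt0 _ _ (splits_at_affine q _ NfA) Nfq) => v.
  by rewrite oppr_gt0 => /ltr0_norm.
- exists 0, (fun v => `|dotp a v|); split => [v|m v m0|x|].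
  + by rewrite dotpNr normrN.
  + by rewrite dotpZr normrM ger0_norm.
  + exact: cvg_norm (dotp_continuous a x).
  + apply: filterE => v; rewrite -fq normr0 dotp0l !add0r fE dotpDr addrAC -fE.
    by rewrite -fq add0r.
Qed.

Lemma hinge_splits_at q h : hinge_function h -> splits_at q h.
Proof.
move=> [s [t [L [st LA hE]]]]; rewrite (funext hE).
apply: splits_atD; first apply: splits_atD.
- exact/splits_at_affine/LA.
- apply: splits_at_sum => i; rewrite mem_index_iota ltnS => /andP[_ si].
  by apply/splits_at_norm_affine/LA/(leq_trans si).
- apply/splits_atN/splits_at_sum => i; rewrite mem_index_iota ltnS => /andP[_ it].
  exact/splits_at_norm_affine/LA.
Qed.

End LocalSplitting.

(** * Local cones and the separating linear form *)

Section LocalCone.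
Context {R : realType} {d : nat}.
Implicit Types (P C : set 'rV[R]_d) (q v a : 'rV[R]_d).

(** This removes the radius: [v] lies in the cone exactly when the ray from [q] in direction [v]
    starts inside [P]. Conicality slides a given point of [P] towards [q]; conversely, any small
    point of the ray can be rescaled to [v]. *)
Lemma local_coneP P q C v : is_local_cone P q C ->
  C v <-> \forall m \near 0^'+, P (q + m *: v).
Proof.
move=> [e [[e0 con] ->]]; split => [[p [l [Pp pe l0 ->]]]|Pv].
  (* [conical_radius] only speaks of [p != q]; for [p = q] the direction is zero and the ray stays
     at [q]. *)
  have [pq|pq] := eqVneq p q.
    by apply: filterE => m; rewrite pq subrr !scaler0 addr0 -pq.
  near=> m; have m0 : 0 < m by near: m; exact: nbhs_right_gt.
  rewrite scalerA; apply: con => //; first exact: mulr_gt0.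
  rewrite -scalerA; near: m; exact: near_eball_ray.
have [m [[Pm em] m0]] : exists m, (P (q + m *: v) /\ eball q e (q + m *: v)) /\ 0 < m.
  apply: (@filter_ex _ (0^'+ : set_system R)).
  apply: filterS3 Pv (near_eball_ray q v e e0) (nbhs_right_gt 0) => m.
  by split.
exists (q + m *: v), m^-1; split => //; first by rewrite invr_gt0.
by rewrite addrAC subrr add0r scalerA mulVf ?gt_eqF// scale1r.
Unshelve. all: by end_near. Qed.

(** At a common point [dotp a] would vanish, yet on the hull it is a sum of nonnegative terms
    [c i * dotp a (r i)]. All these terms are then zero, so every weight is zero, although the
    weights sum to 1. *)
Lemma span_hull_disjoint C a :
  (forall v, paired_boundary C v -> dotp a v = 0) ->
  (forall v, unpaired_part C v -> 0 < dotp a v) ->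
  linear_span (paired_boundary C) `&` convex_hull (unpaired_part C) = set0.
Proof.
move=> aG aR; rewrite -subset0 => _ [[m [g [b [Gg ->]]]] [n [r [c [Rr c0 c1 e]]]]].
have := congr1 (dotp a) e; rewrite !dotp_sumr big1 => [/esym/eqP|i _]; last first.
  by rewrite aG ?mulr0.
have cr i : 0 <= c i * dotp a (r i) by rewrite mulr_ge0// ltW// aR.
rewrite psumr_eq0// => /allP cr0.
suff c_eq0 : \sum_i c i = 0 by move: c1; rewrite c_eq0 => /eqP; rewrite eq_sym oner_eq0.
apply: big1 => i _; have := cr0 i (mem_index_enum i).
by rewrite /= mulf_eq0 (gt_eqF (aR _ (Rr i))) orbF => /eqP.
Qed.

(** By continuity the sign of [k v] persists near [v]: a positive value puts [v] in the interior, a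
    negative one keeps it out of the closure. *)
Lemma boundary_positivity_set (k : 'rV[R]_d -> R) v :
  continuous k -> boundary (positivity_set k) v -> k v = 0.
Proof.
move=> kc [clv intv]; apply/eqP; rewrite eq_le; apply/andP; split.
  rewrite leNgt; apply/negP => kv; apply: intv.
  exact: (cvgr_gt _ (kc v) _ kv).
rewrite leNgt; apply/negP => kv.
have [w [/= + /lt_le_trans]] := clv _ (cvgr_lt _ (kc v) _ kv).
by move=> kw /(_ _ (ltW kw)); rewrite ltxx.
Qed.

(** Near [q] the function keeps the sign of [h q], so either all directions or none belong to the
    cone. *)
Lemma local_cone_positivity_set_neq0 (h : 'rV[R]_d -> R) q C v :
  is_local_cone (positivity_set h) q C -> splits_at q h -> h q != 0 ->
  C v <-> 0 < h q.
Proof.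
move=> HC hs hq0; rewrite (local_coneP _ _ _ _ HC); split => [hv|hq]; last first.
  exact: near0_ray (splits_at_near_gt0 _ _ hs hq).
rewrite lt_neqAle eq_sym hq0 leNgt; apply/negP => hq.
have Nhq : 0 < - h q by rewrite oppr_gt0.
have /(near0_ray v) Nhv := splits_at_near_gt0 _ _ (splits_atN _ _ hs) Nhq.
have [m [/= hm]] := filter_ex (filterI hv Nhv).
by rewrite oppr_gt0 ltNge (ltW hm).
Qed.

(** For small [m > 0] the value [h (q + m *: v)] is [m * (dotp a v + g v)], whose sign does not
    depend on [m]. *)
Lemma local_cone_positivity_set (h g : 'rV[R]_d -> R) q a C :
  is_local_cone (positivity_set h) q C ->
  (forall m v, 0 <= m -> g (m *: v) = m * g v) ->
  (\forall v \near (0 : 'rV[R]_d), h (q + v) = h q + (dotp a v + g v)) ->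
  h q = 0 -> C = positivity_set (fun v => dotp a v + g v).
Proof.
move=> HC gZ hE hq0; apply/seteqP; split => v.
  move=> /(local_coneP _ _ _ _ HC) Pv.
  have [m []] : exists m, 0 < h (q + m *: v) /\ 0 < m /\
      h (q + m *: v) = h q + (dotp a (m *: v) + g (m *: v)).
    apply: (@filter_ex _ (0^'+ : set_system R)).
    by apply: filterS3 Pv (nbhs_right_gt 0) (near0_ray v _ hE) => m.
  move=> hm [m0 em]; move: hm; rewrite em hq0 add0r dotpZr gZ ?ltW// -mulrDr.
  by rewrite pmulr_rgt0.
move=> kv; apply/(local_coneP _ _ _ _ HC).
apply: filterS2 (nbhs_right_gt 0) (near0_ray v _ hE) => m m0.
rewrite /positivity_set /= => ->.
by rewrite hq0 add0r dotpZr gZ ?ltW// -mulrDr mulr_gt0.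
Qed.

End LocalCone.

Theorem theorem2 (R : realType) (d : nat) (P : set 'rV[R]_d) :
  (1 <= d)%N ->
  polytopal P ->
  (exists (q : 'rV[R]_d) (C : set 'rV[R]_d),
     is_local_cone P q C /\
     linear_span (paired_boundary C) `&` convex_hull (unpaired_part C) !=set0) ->
  ~ (exists h : 'rV[R]_d -> R, hinge_function h /\ P = positivity_set h).
Proof.
move=> _ _ [q [C [HC /set0P/eqP GR]]] [h [hh PE]]; apply: GR; subst P.
have hs := hinge_splits_at q h hh.
have [hq0|hq0] := eqVneq (h q) 0; last first.
  have CE v := local_cone_positivity_set_neq0 _ _ _ v HC hs hq0.
  (* Membership in [C] is the same for [v] and [- v], so the unpaired part is empty and the zero
     form satisfies the positivity condition vacuously. *)
  apply: (span_hull_disjoint _ 0) => v; first by rewrite dotp0l.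
  by move=> -[/CE hq []]; apply/CE.
have [a [g [gN gZ gc hE]]] := hs.
have CE := local_cone_positivity_set _ _ _ _ _ HC gZ hE hq0.
apply: (span_hull_disjoint _ a) => v; rewrite CE.
  have kc : continuous (fun v => dotp a v + g v).
    by move=> x; exact: cvgD (dotp_continuous a x) (gc x).
  move=> [/(boundary_positivity_set _ _ kc) + /(boundary_positivity_set _ _ kc)].
  by rewrite dotpNr gN; lra.
rewrite /unpaired_part /positivity_set /= dotpNr gN => -[kv /negP].
by rewrite -leNgt; lra.
Qed.
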